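(* There is an absolute constant $C$ such that the following holds. Let $\mathcal F$ be a class of $k$ linear queries over a data universe of size $N$, let $0<\epsilon<1$, $0<\beta<1$ and let $n$ be the starting database size. Then $\textsc{SmallDBG}(X,F,\mathcal F,\epsilon,\alpha,\beta,n)$ is $\epsilon$-differentially private, and for every database stream $X$ and every query stream $F$ whose queries lie in $\mathcal F$, it answers all queries of $F$ with $(\alpha,\beta)$-accuracy whenever $$\alpha\ \ge\ C\left(\frac{\log N\,\log k\,\log(1/\beta)}{\epsilon n}\right)^{1/5}.$$
   Context: Data universe $\mathcal X$ of finite size $N$, identified with $[N]$. A database of size $t$ is a histogram $x\in\Delta(\mathcal X)\subseteq\mathbb R^N$ with $x^i=n_i/t$, $n_i\in\mathbb N$, $\sum_i n_i=t$; two databases of the same size are neighboring if they differ in one entry. A linear query is a vector $f\in[0,1]^N$ with value $f(x)=\langle f,x\rangle$. A database stream $X=\{x_t\}_{t\ge n}$ consists of databases $x_t$ of size $t$, with $x_{t+1}$ obtained from $x_t$ by adding one entry. Streams $X,X'$ are neighboring if for some $t\ge n$, $x_\tau=x'_\tau$ for $n\le \tau<t$ and $x_\tau,x'_\tau$ are neighboring for all $\tau\ge t$. A query stream is $F=\{\{f_{t,j}\}_{j=1}^{\ell_t}\}_{t\ge n}$, where $f_{t,j}$ arrives when the database has size $t$. An algorithm on streams is $\epsilon$-differentially private if for all neighboring streams $X,X'$ and every set $S$ of output transcripts, $\Pr[\mathcal M(X)\in S]\le e^{\epsilon}\Pr[\mathcal M(X')\in S]$. It is $(\alpha,\beta)$-accurate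 for $F$ if for every database stream, with probability at least $1-\beta$, every query $f_{t,j}$ receives an answer $a_{t,j}$ with $|f_{t,j}(x_t)-a_{t,j}|\le\alpha$. $\textsc{SmallDB}(x,\mathcal F,\epsilon',\alpha',\beta',m)$ (Blum–Ligett–Roth), on a database $x$ of size $m$, outputs a database $y$ of size $\lceil \log k/\alpha'^2\rceil$ sampled with probability proportional to $\exp\!\big(-\epsilon' m\max_{f\in\mathcal F}|f(x)-f(y)|/2\big)$, and answers $f$ by $f(y)$. $\textsc{SmallDBG}$ is the following scheduler with $p=1/3$, $g=(64\log N\log k)^{1/3}$ and black box $\textsc{SmallDB}$: set $\gamma=g^{1/(2p+1)}\big(\log(1/\beta)/(\epsilon n)\big)^{p/(2p+1)}$; for $i=0,1,2,\dots$, epoch $i$ consists of times $t_i\le t<t_{i+1}$ where $t_i=(1+\gamma)^i n$ (assumed integral). At time $t_i$ set $\epsilon_i=\frac{\gamma^2(i+1)}{(1+\gamma)^{i+2}}\epsilon$, $\beta_i=(\beta/(1+\beta))^{i+1}$, $\alpha_i=g\big(\log(1/\beta_i)/(\epsilon_i t_i)\big)^p$, and compute $y_i=\textsc{SmallDB}(x_{t_i},\mathcal F,\epsilon_i,\alpha_i,\beta_i,t_i)$; every query arriving during epoch $i$ is answered using $y_i$.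
   Formalization: The epoch times t_i are rounded up to integers, N, k ≥ 2 and n ≥ 1 are required, and accuracy is claimed for β ≤ 1/2, or for all 0<β<1 when every t_i is exactly integral: with rounded times the accuracy bound fails as β tends to 1. Privacy is for all 0<β<1. *)

(* Defs.v *)
From HB Require Import structures.
From mathcomp Require Import all_boot all_order all_algebra.
From mathcomp Require Import all_classical all_reals all_analysis.

Set Implicit Arguments.
Unset Strict Implicit.
Unset Printing Implicit Defensive.

Import Order.TTheory GRing.Theory Num.Theory.

Local Open Scope classical_set_scope.
Local Open Scope ring_scope.

(* A database over the universe 'I_N is given by its entry counts n_i; its
   size is the sum of the n_i, and its histogram has entries n_i / size. *)
Definition dbase (N : nat) := {ffun 'I_N -> nat}.

HB.instance Definition _ (N : nat) := Choice.on (dbase N).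
HB.instance Definition _ (N : nat) :=
  isPointed.Build (dbase N) [ffun=> 0%N].

Definition dbsize (N : nat) (x : dbase N) : nat := (\sum_(i < N) x i)%N.

Definition hist (R : realType) (N : nat) (x : dbase N) : 'rV[R]_N :=
  \row_i ((x i)%:R / (dbsize x)%:R).

Definition add_entry (N : nat) (x : dbase N) (j : 'I_N) : dbase N :=
  [ffun i => (x i + (i == j))%N].

(* Replacing one entry j of x by an entry i != j gives x'. *)
Definition db_neighbor (N : nat) (x x' : dbase N) : Prop :=
  exists i j : 'I_N, i != j /\ add_entry x i = add_entry x' j.

Definition linear_query (R : realType) (N : nat) (f : 'rV[R]_N) : Prop :=
  forall i, 0 <= f 0 i <= 1.

Definition qval (R : realType) (N : nat) (f : 'rV[R]_N) (x : dbase N) : R :=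
  \sum_(i < N) f 0 i * hist R x 0 i.

(* Only the values at times t >= n of a database or query stream matter. *)
Definition stream (N : nat) := nat -> dbase N.

Definition is_stream (N n : nat) (X : stream N) : Prop :=
  forall t, (n <= t)%N ->
    dbsize (X t) = t /\ exists j, X t.+1 = add_entry (X t) j.

Definition stream_neighbor (N n : nat) (X X' : stream N) : Prop :=
  exists t, [/\ (n <= t)%N,
    forall tau, (n <= tau < t)%N -> X tau = X' tau &
    forall tau, (t <= tau)%N -> db_neighbor (X tau) (X' tau)].

Definition query_stream (R : realType) (N : nat) := nat -> seq 'rV[R]_N.

(* Sequences (y_i)_i of released databases, with the product sigma-algebra. *)
Definition cylinders (N : nat) : set (set (nat -> dbase N)) :=
  [set A | exists (i : nat) (y : dbase N), A = [set w | w i = y]].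
Definition releases (N : nat) := g_sigma_algebraType (@cylinders N).

(* An output transcript: the databases released in the successive epochs,
   and for each time t the answers to the queries arriving at time t. *)
Definition transcript (R : realType) (N : nat) : Type :=
  ((nat -> dbase N) * (nat -> seq R))%type.

(* A randomized algorithm on streams: M X is the law of its random releases
   on input X, and the transcript is the function out of these releases. *)
Definition diff_private (R : realType) (N n : nat) (eps : R)
    (M : stream N -> probability (releases N) R)
    (out : releases N -> transcript R N) : Prop :=
  forall X X' : stream N, is_stream n X -> is_stream n X' ->
    stream_neighbor n X X' ->
  forall S : set (transcript R N), measurable (out @^-1` S) ->
    (M X (out @^-1` S) <= (expR eps)%:E * M X' (out @^-1` S))%E.

Definition accurate (R : realType) (N n : nat) (alpha beta : R)
    (F : query_stream R N)
    (M : stream N -> probability (releases N) R)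
    (out : releases N -> transcript R N) : Prop :=
  forall X : stream N, is_stream n X ->
    ((1 - beta)%:E <= M X [set w | forall t j : nat,
        (n <= t)%N -> (j < size (F t))%N ->
        `|qval (nth 0 (F t) j) (X t) - nth 0 ((out w).2 t) j| <= alpha]%R)%E.

Definition natceil (R : realType) (x : R) : nat := `|Num.ceil x|%N.

Definition query_dist (R : realType) (N : nat) (Fc : seq 'rV[R]_N)
    (x y : dbase N) : R :=
  \big[Num.max/0]_(f <- Fc) `|qval f x - qval f y|.

Definition smallDB_size (R : realType) (k : nat) (alpha : R) : nat :=
  natceil (ln k%:R / alpha ^+ 2).

Definition smallDB_weight (R : realType) (N : nat) (Fc : seq 'rV[R]_N)
    (eps : R) (m : nat) (x y : dbase N) : R :=
  expR (- (eps * m%:R * query_dist Fc x y / 2)).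

Definition dbase_of (N l : nat) (z : {ffun 'I_N -> 'I_l.+1}) : dbase N :=
  [ffun i => nat_of_ord (z i)].

(* Probability that SmallDB outputs y. The counts of a database of size l are
   at most l, so the normalizing sum ranges over all databases of size l. The
   parameter beta of SmallDB does not occur in its definition. *)
Definition smallDB (R : realType) (N : nat) (x : dbase N)
    (Fc : seq 'rV[R]_N) (eps alpha : R) (m : nat) (y : dbase N) : R :=
  let l := smallDB_size (size Fc) alpha in
  if dbsize y == l then
    smallDB_weight Fc eps m x y /
    \sum_(z : {ffun 'I_N -> 'I_l.+1} | dbsize (dbase_of z) == l)
       smallDB_weight Fc eps m x (dbase_of z)
  else 0.

(* Parameters of the scheduler for a black box with exponent p and factor g. *)
Definition gammaG (R : realType) (p g eps beta : R) (n : nat) : R :=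
  g `^ (2 * p + 1)^-1 * (ln beta^-1 / (eps * n%:R)) `^ (p / (2 * p + 1)).

Definition real_time (R : realType) (p g eps beta : R) (n i : nat) : R :=
  (1 + gammaG p g eps beta n) ^+ i * n%:R.

(* Rounding up does nothing when all the real_time's are integral; in general
   the integers t with real_time i <= t < real_time i.+1 are exactly those
   with epoch_time i <= t < epoch_time i.+1. *)
Definition epoch_time (R : realType) (p g eps beta : R) (n i : nat) : nat :=
  natceil (real_time p g eps beta n i).

Definition epoch_eps (R : realType) (p g eps beta : R) (n i : nat) : R :=
  let gamma := gammaG p g eps beta n in
  gamma ^+ 2 * i.+1%:R / (1 + gamma) ^+ i.+2 * eps.

Definition epoch_beta (R : realType) (beta : R) (i : nat) : R :=
  (beta / (1 + beta)) ^+ i.+1.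

Definition epoch_alpha (R : realType) (p g eps beta : R) (n i : nat) : R :=
  g * (ln (epoch_beta beta i)^-1 /
       (epoch_eps p g eps beta n i *
        (epoch_time p g eps beta n i)%:R)) `^ p.

(* The epoch containing time t; it is unique, since epoch_time is
   nondecreasing in i. *)
Definition epoch_of (R : realType) (p g eps beta : R) (n t : nat) : nat :=
  xget 0%N [set i | (epoch_time p g eps beta n i <= t
                       < epoch_time p g eps beta n i.+1)%N].

Definition pG (R : realType) : R := 3^-1.

Definition gG (R : realType) (N k : nat) : R :=
  (64 * ln N%:R * ln k%:R) `^ 3^-1.

(* M X is the law of the independent draws
   y_i = SmallDB (x_{t_i}, Fc, eps_i, alpha_i, beta_i, t_i), i = 0, 1, ... *)
Definition smallDBG_releases (R : realType) (N : nat) (Fc : seq 'rV[R]_N)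
    (eps beta : R) (n : nat)
    (M : stream N -> probability (releases N) R) : Prop :=
  let p := pG R in
  let g := gG R N (size Fc) in
  forall X : stream N, is_stream n X ->
  forall (m : nat) (y : nat -> dbase N),
    M X [set w | forall i : nat, (i < m)%N -> w i = y i] =
    (\prod_(i < m)
       smallDB (X (epoch_time p g eps beta n i)) Fc
         (epoch_eps p g eps beta n i) (epoch_alpha p g eps beta n i)
         (epoch_time p g eps beta n i) (y i))%:E.

Definition smallDBG_out (R : realType) (N k : nat) (eps beta : R) (n : nat)
    (F : query_stream R N) (w : releases N) : transcript R N :=
  (w, fun t => [seq qval f (w (epoch_of (pG R) (gG R N k) eps beta n t))
               | f <- F t]).

(* Main.v *)
Require Import Defs.
From mathcomp Require Import all_boot all_order all_algebra.
From mathcomp Require Import all_classical all_reals all_analysis.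
From mathcomp Require Import ring lra.

Set Implicit Arguments.
Unset Strict Implicit.
Unset Printing Implicit Defensive.

Import Order.TTheory GRing.Theory Num.Theory.

Local Open Scope classical_set_scope.
Local Open Scope ring_scope.

(* Privacy: replacing one entry of a database of size m moves every query by at
   most 1/m, so epoch i multiplies the density of its release by at most
   e^(eps_i), and the eps_i sum to eps.  The resulting inequality on cylinders
   passes to all measurable sets by the monotone class theorem.

   Accuracy: if 16 gamma > 1 the bound on alpha exceeds 1 and nothing has to be
   proved.  If all the times (1 + gamma)^i n are integers, then gamma >= 1.
   Otherwise beta <= 1/2, and then alpha_i <= 2 gamma.  An exponential potential
   argument gives a database of size l = ceil(log k / alpha_i^2) within
   4 alpha_i of the true one; as there are at most N^l databases of size l,
   epoch i releases one that is not within 5 alpha_i with probability at most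
   beta_i, and the beta_i sum to beta.  During an epoch the queries drift by at
   most gamma. *)

(** * Elementary real estimates: rounding up, Bernoulli, logarithm, exponential *)

Section RealBounds.
Context {R : realType}.
Implicit Types r x : R.

Lemma natceil_ge (r : R) : r <= (natceil r)%:R.
Proof.
rewrite /natceil natr_absz; apply: le_trans (ceil_ge r) _.
by rewrite ler_int; exact: ler_norm.
Qed.

Lemma natceil_le r (t : nat) : 0 <= r -> (natceil r <= t)%N = (r <= t%:R).
Proof.
move=> r0; have c0 : 0 <= Num.ceil r by rewrite ceil_ge0; lra.
by rewrite pmulrn -ceil_le_int -lez_nat (gez0_abs c0).
Qed.

Lemma natceil_gt r (t : nat) : 0 <= r -> (t < natceil r)%N = (t%:R < r).
Proof. by move=> r0; rewrite ltnNge natceil_le// -ltNge. Qed.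

Lemma natceil_lt r : 0 <= r -> (natceil r)%:R < r + 1.
Proof.
move=> r0; case e : (natceil r) => [|t]; first by lra.
have : (t < natceil r)%N by rewrite e.
by rewrite natceil_gt// -natr1; lra.
Qed.

Lemma bernoulli x (i : nat) : 0 <= x -> 1 + i%:R * x <= (1 + x) ^+ i.
Proof.
move=> x0; elim: i => [|i IH]; first by rewrite mul0r addr0.
rewrite exprS; apply: le_trans (ler_wpM2l _ IH); last by lra.
rewrite -natr1.
have : 0 <= i%:R * (x * x) by rewrite !mulr_ge0.
lra.
Qed.

Lemma expr_unbounded x (b : R) : 0 < x -> exists i, b < (1 + x) ^+ i.
Proof.
move=> x0; exists (Num.bound (b / x)).
apply: lt_le_trans (bernoulli _ (ltW x0)).
have := @archi_boundP _ (b / x); set m := Num.bound _.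
have [b0|b0] := leP 0 b.
  by move=> /(_ (divr_ge0 b0 (ltW x0))); rewrite ltr_pdivrMr//; lra.
move=> _; have : 0 <= m%:R * x by rewrite mulr_ge0// ltW.
lra.
Qed.

(* c gamma^i is an integer combination of the c (1 + gamma)^j, so it is a
   positive integer for every i, which is impossible when gamma < 1. *)
Lemma integral_powers_ge1 (gamma c : R) : 0 < gamma -> 0 < c ->
  (forall i, (1 + gamma) ^+ i * c \is a Num.int) -> 1 <= gamma.
Proof.
move=> g0 c0 H.
(* The index [j] stays general because [gamma = (1 + gamma) - 1] trades one factor [gamma] for a
   step in [j]. *)
have H' i j : gamma ^+ i * ((1 + gamma) ^+ j * c) \is a Num.int.
  elim: i j => [|i IH] j; first by rewrite mul1r.
  have -> : gamma ^+ i.+1 * ((1 + gamma) ^+ j * c) =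
    gamma ^+ i * ((1 + gamma) ^+ j.+1 * c) - gamma ^+ i * ((1 + gamma) ^+ j * c).
    by rewrite !exprS; ring.
  exact: rpredB.
have {}H' i : 1 <= gamma ^+ i * c.
  have := H' i 0%N; rewrite expr0 mul1r => /intrP[z e].
  have : 0 < gamma ^+ i * c by rewrite mulr_gt0// exprn_gt0.
  by rewrite e ltr0z gtz0_ge1 -(ler_int R).
rewrite leNgt; apply/negP => g1.
(* Unbounded powers of [gamma^-1] give an [i] with [c < gamma^-1 ^+ i], against
   [1 <= gamma ^+ i * c]. *)
have g1' : 0 < gamma^-1 - 1 by rewrite subr_gt0 invf_gt1.
have [i] := expr_unbounded c g1'.
rewrite addrC subrK exprVn ltNge => /negP; apply.
by rewrite -[leLHS]mulr1 ler_pdivrMl ?exprn_gt0.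
Qed.

(** From [x^-1 = exp (- ln x) >= 1 - ln x]. It later lets additive terms be absorbed into products
    of logarithms. *)
Lemma ln_ge_half x : 2 <= x -> 2^-1 <= ln x.
Proof.
move=> x2; have x0 : 0 < x by lra.
have := expR_ge1Dx (- ln x); rewrite expRN lnK ?posrE// => h.
have : x^-1 <= 2^-1 by rewrite lef_pV2// posrE; lra.
lra.
Qed.

(** Since [exp (- s) >= 1 - s], one has [exp s <= 1 / (1 - s)]; and [(1 + s + 2 s^2) (1 - s) = 1 +
    s^2 (1 - 2 s) >= 1]. *)
Lemma expR_le_quad (s : R) : s <= 2^-1 -> expR s <= 1 + s + 2 * s ^+ 2.
Proof.
move=> s2; have h := expR_ge1Dx (- s).
have s1 : 0 < 1 - s by lra.
have : expR s * (1 - s) <= 1.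
  by rewrite -[leRHS](expRxMexpNx_1 s) ler_pM2l ?expR_gt0.
rewrite -ler_pdivlMr// => /le_trans; apply.
rewrite ler_pdivrMr//.
have : 0 <= s ^+ 2 * (1 - 2 * s) by rewrite mulr_ge0 ?sqr_ge0//; lra.
lra.
Qed.

End RealBounds.

(** * Laws on sequences of releases: cylinders, product laws, monotone classes *)

Section Releases.
Context {N : nat}.
Implicit Types (y : nat -> dbase N) (b : dbase N).

Definition prefix_set (m : nat) y : set (releases N) :=
  [set w | forall i, (i < m)%N -> w i = y i].

Definition coord_set (j : nat) b : set (releases N) := [set w | w j = b].

(** Overwriting one entry keeps prefixes as total sequences, so fixing one more coordinate yields a
    [prefix_set] again. *)
Definition upd y j b : nat -> dbase N := fun i => if i == j then b else y i.

Lemma measurable_coord_set j b : measurable (coord_set j b).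
Proof. by apply: sub_sigma_algebra; exists j, b. Qed.

(** [dbase N] is countable, so the event is a countable union of generators, enumerated through
    [pickle]. *)
Lemma measurable_coord j (P : set (dbase N)) :
  measurable ([set w | P (w j)] : set (releases N)).
Proof.
pose D n : set (releases N) :=
  if unpickle n is Some b then [set w | w j = b /\ P b] else set0.
rewrite [X in measurable X](_ : _ = \bigcup_n D n).
  apply: bigcupT_measurable => n; rewrite /D; case: unpickle => [b|]//.
  have [Pb|nPb] := pselect (P b).
    rewrite [X in measurable X](_ : _ = coord_set j b); last first.
      by apply/seteqP; split => w /=; [case|].
    exact: measurable_coord_set.
  by rewrite [X in measurable X](_ : _ = set0)//; apply/seteqP; split => w //= [].
apply/seteqP; split => w /=.
  move=> Pw; exists (pickle (w j : {ffun 'I_N -> nat})) => //.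
  by rewrite /D pickleK.
by move=> [n _]; rewrite /D; case: unpickle => [b|]//= [->].
Qed.

Lemma prefix_setS m y : prefix_set m.+1 y = prefix_set m y `&` coord_set m (y m).
Proof.
apply/seteqP; split => w /=.
  by move=> H; split; [move=> i im; apply: H; exact: leqW|exact: H].
move=> [H Hm] i; rewrite ltnS leq_eqVlt => /orP[/eqP->//|]; exact: H.
Qed.

Lemma prefix_set_upd j y b :
  prefix_set j y `&` coord_set j b = prefix_set j.+1 (upd y j b).
Proof.
rewrite prefix_setS {2}/upd eqxx; congr (_ `&` _).
by apply/seteqP; split => w /= H i ij; rewrite (H i ij) /upd (ltn_eqF ij).
Qed.

Lemma measurable_prefix_set m y : measurable (prefix_set m y).
Proof.
elim: m => [|m IH].
  rewrite [X in measurable X](_ : _ = setT)//.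
  by apply/seteqP; split.
by rewrite prefix_setS; apply: measurableI => //; exact: measurable_coord_set.
Qed.

Context {R : realType}.
Implicit Types mu : probability (releases N) R.

(** The values of coordinate [j] outside [D] cut out countably many null pieces of [A]; finite
    subadditivity handles the others. *)
Lemma measure_coord_le mu (A : set (releases N)) (j : nat) (D : seq (dbase N)) :
  measurable A -> (forall b, b \notin D -> mu (A `&` coord_set j b) = 0%E) ->
  (mu A <= \sum_(b <- D) mu (A `&` coord_set j b))%E.
Proof.
move=> mA H0.
pose Z n : set (releases N) :=
  if unpickle n is Some b then
    if (b : dbase N) \in D then set0 else A `&` coord_set j b else set0.
have mZ n : measurable (Z n).
  rewrite /Z; case: unpickle => [b|]//; case: ifP => // _.
  by apply: measurableI => //; exact: measurable_coord_set.
have Z0 : mu (\bigcup_n Z n) = 0%E.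
  apply/negligibleP; first exact: bigcupT_measurable.
  apply: negligible_bigcup => n; apply/negligibleP => //.
  rewrite /Z; case: unpickle => [b|]; last exact: measure0.
  case: ifPn => [_|bD]; [exact: measure0|exact: H0].
have mD : measurable (\big[setU/set0]_(b <- D) (A `&` coord_set j b)).
  by apply: bigsetU_measurable => b _; apply: measurableI => //;
     exact: measurable_coord_set.
apply: (@le_trans _ _ (mu (\bigcup_n Z n `|` \big[setU/set0]_(b <- D) (A `&` coord_set j b)))).
  apply: le_measure; rewrite ?inE//.
    by apply: measurableU => //; exact: bigcupT_measurable.
  move=> w Aw; have [wD|wD] := boolP ((w j : dbase N) \in D).
    by right; rewrite -bigcup_seq; exists (w j).
  left; exists (pickle (w j : {ffun 'I_N -> nat})) => //.
  by rewrite /Z pickleK (negbTE wD).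
apply: (le_trans (measureU2 _ _ _)) => //; first exact: bigcupT_measurable.
rewrite [X in (X + _)%E]Z0 add0e.
elim: D {H0 Z mZ Z0} mD => [|b D IH] mD.
  by rewrite !big_nil measure0.
have mb : measurable (A `&` coord_set j b).
  by apply: measurableI => //; exact: measurable_coord_set.
have mD' : measurable (\big[setU/set0]_(b <- D) (A `&` coord_set j b)).
  by apply: bigsetU_measurable => b' _; apply: measurableI => //;
     exact: measurable_coord_set.
rewrite !big_cons; apply: (le_trans (measureU2 _ _ _)) => //.
by apply: leeD => //; exact: IH.
Qed.

(** The pieces are disjoint: removing [coord_set j b] from [A] leaves the pieces of the other values
    intact. *)
Lemma measure_coord_ge mu (A : set (releases N)) (j : nat) (D : seq (dbase N)) :
  measurable A -> uniq D ->
  (\sum_(b <- D) mu (A `&` coord_set j b) <= mu A)%E.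
Proof.
move=> mA; elim: D A mA => [|b D IH] A mA /=.
  by rewrite big_nil measure_ge0.
move=> /andP[bD uD]; rewrite big_cons.
have mb := measurable_coord_set j b.
have mAb : measurable (A `&` coord_set j b) by exact: measurableI.
have mAD : measurable (A `\` coord_set j b) by exact: measurableD.
rewrite [leRHS](@measureDI _ _ _ mu A (coord_set j b))// addeC leeD//.
apply: le_trans (IH _ mAD uD).
rewrite big_seq [leRHS]big_seq; apply: lee_sum => c cD.
apply: le_measure; rewrite ?inE.
- by apply: measurableI => //; exact: measurable_coord_set.
- by apply: measurableI => //; exact: measurable_coord_set.
move=> w [Aw wc]; split => //; split => // wb.
by move: bD; rewrite -[b]wb [w j]wc cD.
Qed.

(** Independence is expressed on prefixes only. Total mass at most 1 covers a [smallDB] whose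
    normalizing sum is 0. *)
Definition product_law mu (p : nat -> dbase N -> R) (D : nat -> seq (dbase N)) :=
  [/\ forall j b, 0 <= p j b,
      forall j b, b \notin D j -> p j b = 0,
      forall j, \sum_(b <- D j) p j b <= 1 &
      forall m y, mu (prefix_set m y) = (\prod_(i < m) p i (y i))%:E].

Lemma prod_upd (p : nat -> dbase N -> R) j y b :
  \prod_(i < j.+1) p i (upd y j b i) = (\prod_(i < j) p i (y i)) * p j b.
Proof.
rewrite big_ord_recr /= {2}/upd eqxx; congr (_ * _).
by apply: eq_bigr => i _; rewrite /upd (ltn_eqF (ltn_ord i)).
Qed.

Lemma product_law_null mu p D : product_law mu p D ->
  forall (E : set (releases N)) j y b, measurable E -> b \notin D j ->
  mu (prefix_set j y `&` E `&` coord_set j b) = 0%E.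
Proof.
move=> [p0 pD _ muE] E j y b mE bD.
rewrite setIAC prefix_set_upd.
apply: (@subset_measure0 _ _ _ mu _ (prefix_set j.+1 (upd y j b))) => //.
- by apply: measurableI => //; exact: measurable_prefix_set.
- exact: measurable_prefix_set.
- by rewrite [LHS]muE prod_upd pD// mulr0.
Qed.

(** The coordinates before [i] are summed out one at a time, each contributing a factor of at most
    1. *)
Lemma product_law_marginal mu p D : product_law mu p D ->
  forall i (B : pred (dbase N)) (d : R), \sum_(b <- D i | B b) p i b <= d ->
  (mu ([set w | B (w i)] : set (releases N)) <= d%:E)%E.
Proof.
move=> L i B d Hd; have [p0 pD p1 muE] := L.
pose E : set (releases N) := [set w | B (w i)].
rewrite -/E.
have mE : measurable E by exact: (@measurable_coord i [set b | B b]).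
(* A prefix of length [j] is fixed, and [k] coordinates are still free before coordinate [i]. *)
suff H k j y : (j + k = i)%N ->
    (mu (prefix_set j y `&` E) <= ((\prod_(i < j) p i (y i)) * d)%:E)%E.
  have := H i 0%N (fun=> point) (add0n _).
  rewrite big_ord0 mul1r [X in mu X](_ : _ = E)//.
  by apply/seteqP; split => [w []//|w Ew]; split.
elim: k j y => [|k IH] j y jk.
  rewrite addn0 in jk; subst j.
  apply: (le_trans (@measure_coord_le mu _ i (D i) _ _)).
  - by apply: measurableI => //; exact: measurable_prefix_set.
  - by move=> b bD; apply: (product_law_null L).
  apply: (@le_trans _ _ (\sum_(b <- D i | B b) ((\prod_(j < i) p j (y j)) * p i b)%:E)%E).
    rewrite [leRHS]big_mkcond; apply: lee_sum => b _; case: ifPn => Bb.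
      rewrite -(prod_upd p i y b) -muE -prefix_set_upd setIAC.
      apply: le_measure; rewrite ?inE.
      - apply: measurableI => //; apply: measurableI.
          exact: measurable_prefix_set.
        exact: measurable_coord_set.
      - apply: measurableI; first exact: measurable_prefix_set.
        exact: measurable_coord_set.
      - by move=> w [].
    rewrite [X in mu X](_ : _ = set0) ?measure0//.
    apply/seteqP; split => // w [[_ Ew] wb]; move: Bb.
    by rewrite -[b]wb => /negP; apply.
  rewrite sumEFin lee_fin -mulr_sumr ler_wpM2l// prodr_ge0//.
have ji : (j < i)%N by rewrite -jk addnS ltnS leq_addr.
apply: (le_trans (@measure_coord_le mu _ j (D j) _ _)).
- by apply: measurableI => //; exact: measurable_prefix_set.
- by move=> b bD; apply: (product_law_null L).
apply: (@le_trans _ _ (\sum_(b <- D j) ((\prod_(j0 < j) p j0 (y j0)) * p j b * d)%:E)%E).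
  apply: lee_sum => b _; rewrite setIAC prefix_set_upd -(prod_upd p j y b).
  by apply: IH; rewrite addSnnS.
rewrite sumEFin lee_fin -mulr_suml -mulr_sumr.
have d0 : 0 <= d by apply: le_trans Hd; apply: sumr_ge0.
by rewrite ler_wpM2r// ler_piMr// prodr_ge0.
Qed.

(** Induction on the number of free coordinates among the first [m]. Once all are fixed, [A]
    contains the prefix set or misses it. Splitting along [D j] loses no mass of [mu], and the
    disjoint pieces have at most the full mass under [mu']. *)
Lemma product_law_cylinder_le mu mu' p p' D D' (c : R) m (A : set (releases N)) :
  (forall j, uniq (D j)) ->
  product_law mu p D -> product_law mu' p' D' ->
  (forall y, \prod_(i < m) p i (y i) <= c * \prod_(i < m) p' i (y i)) ->
  0 <= c -> measurable A ->
  (forall w w' : releases N, (forall i, (i < m)%N -> w i = w' i) -> A w -> A w') ->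
  (mu A <= c%:E * mu' A)%E.
Proof.
move=> uD L L' Hc c0 mA HA.
have muE : forall m y, _ := (let: And4 _ _ _ h := L in h).
have muE' : forall m y, _ := (let: And4 _ _ _ h := L' in h).
suff H k j y : (j + k = m)%N ->
    (mu (prefix_set j y `&` A) <= c%:E * mu' (prefix_set j y `&` A))%E.
  have := H m 0%N (fun=> point) (add0n _).
  rewrite (_ : prefix_set 0 _ `&` A = A)//.
  by apply/seteqP; split => [w []//|w Ew]; split.
elim: k j y => [|k IH] j y jk.
  rewrite addn0 in jk; subst j.
  have [Ay|Ay] := pselect (A y).
    rewrite (_ : prefix_set m y `&` A = prefix_set m y).
      by rewrite muE muE' -EFinM lee_fin.
    apply/seteqP; split => [w []//|w Ew]; split => //.
    by apply: HA Ay => i im; rewrite Ew.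
  rewrite (_ : prefix_set m y `&` A = set0) ?measure0 ?mule0//.
  by apply/seteqP; split => // w [Pw Aw]; apply: Ay; apply: HA Aw.
have mPA : measurable (prefix_set j y `&` A).
  by apply: measurableI => //; exact: measurable_prefix_set.
apply: (le_trans (@measure_coord_le mu _ j (D j) mPA _)).
  by move=> b bD; apply: (product_law_null L).
apply: (@le_trans _ _ (c%:E * \sum_(b <- D j) mu' (prefix_set j y `&` A `&` coord_set j b))%E).
  rewrite ge0_sume_distrr//.
  apply: lee_sum => b _; rewrite setIAC prefix_set_upd.
  by apply: IH; rewrite addSnnS.
by apply: lee_wpmul2l; rewrite ?lee_fin//; exact: measure_coord_ge.
Qed.

(** One implication encodes dependence on the first [m] coordinates, since agreement of [w] and [w']
    is symmetric. *)
Definition cylinder_ring : set (set (releases N)) :=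
  [set A | measurable A /\ exists m, forall w w' : releases N,
     (forall i, (i < m)%N -> w i = w' i) -> A w -> A w'].

Lemma setring_cylinder_ring : setring cylinder_ring.
Proof.
have ext m k (A : set (releases N)) : (m <= k)%N -> (forall w w' : releases N,
     (forall i, (i < m)%N -> w i = w' i) -> A w -> A w') -> (forall w w' : releases N,
     (forall i, (i < k)%N -> w i = w' i) -> A w -> A w').
  by move=> mk H w w' ww'; apply: H => i im; apply: ww'; exact: leq_trans mk.
split.
- by split => //; exists 0%N.
- move=> A B [mA [m HA]] [mB [k HB]]; split; first exact: measurableU.
  exists (maxn m k) => w w' ww' [Aw|Bw].
    by left; apply: (ext m (maxn m k)) Aw => //; exact: leq_maxl.
  by right; apply: (ext k (maxn m k)) Bw => //; exact: leq_maxr.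
- move=> A B [mA [m HA]] [mB [k HB]]; split; first exact: measurableD.
  exists (maxn m k) => w w' ww' [Aw Bw]; split.
    by apply: (ext m (maxn m k)) Aw => //; exact: leq_maxl.
  move=> Bw'; apply: Bw; apply: (ext k (maxn m k)) Bw' => //.
    exact: leq_maxr.
  by move=> i ik; rewrite ww'.
Qed.

(** The generated sigma-ring contains the full space, hence is closed under complement: it is a
    sigma-algebra containing the generators. *)
Lemma measurable_sub_cylinder_ring (A : set (releases N)) :
  measurable A -> <<sr cylinder_ring >> A.
Proof.
have [S0 SD SU] : sigma_ring <<sr cylinder_ring >> by exact: smallest_sigma_ring.
move: A; apply: smallest_sub.
  split => // A SA; apply: SD => //.
  have cT : cylinder_ring setT by split; [exact: measurableT|exists 0%N].
  exact: (sub_g_sigma_ring cT).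
move=> _ [i [b ->]]; apply: sub_g_sigma_ring; split.
  exact: measurable_coord_set.
by exists i.+1 => w w' H /= <-; rewrite H.
Qed.

(** By continuity of measures, the measurable sets satisfying the inequality form a monotone class;
    containing the ring of cylinders, it contains the sigma-ring generated by it. *)
Lemma cylinder_ring_le mu mu' (c : R) : 0 <= c ->
  (forall A, cylinder_ring A -> (mu A <= c%:E * mu' A)%E) ->
  forall A, measurable A -> (mu A <= c%:E * mu' A)%E.
Proof.
move=> c0 H A mA.
pose G : set (set (releases N)) :=
  [set A | measurable A /\ (mu A <= c%:E * mu' A)%E].
suff : <<sr cylinder_ring >> `<=` G.
  by move=> /(_ A (measurable_sub_cylinder_ring mA)) [].
apply: monotone_setring_sub_g_sigma_ring; last 2 first.
- exact: setring_cylinder_ring.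
- by move=> B RB; split; [case: RB|exact: H].
split => F Fmono GF.
- have mF i : measurable (F i) by case: (GF i).
  have mUF : measurable (\bigcup_i F i) by exact: bigcupT_measurable.
  split => //.
  have c1 := nondecreasing_cvg_mu (mu := mu) mF mUF Fmono.
  have c2 := nondecreasing_cvg_mu (mu := mu') mF mUF Fmono.
  have c3 : ((fun n => c%:E * mu' (F n)) @ \oo --> c%:E * mu' (\bigcup_i F i))%E.
    by apply: cvgeZl.
  apply: (lee_cvg_to c1 c3).
  by apply: nearW => n; case: (GF n).
- have mF i : measurable (F i) by case: (GF i).
  have mUF : measurable (\bigcap_i F i) by exact: bigcapT_measurable.
  split => //.
  (* Continuity from above needs a finite measure at the start of the sequence. *)
  have f1 (nu : probability (releases N) R) : (nu (F 0%N) < +oo)%E.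
    by apply: le_lt_trans (probability_le1 nu (mF 0%N)) _; rewrite ltry.
  have c1 := nonincreasing_cvg_mu (f1 mu) mF mUF Fmono.
  have c2 := nonincreasing_cvg_mu (f1 mu') mF mUF Fmono.
  have c3 : ((fun n => c%:E * mu' (F n)) @ \oo --> c%:E * mu' (\bigcap_i F i))%E.
    by apply: cvgeZl.
  apply: (lee_cvg_to c1 c3).
  by apply: nearW => n; case: (GF n).
Qed.

End Releases.

(** * Databases, linear queries, and privacy and utility of [smallDB] *)

Section Databases.
Context {R : realType} {N : nat}.
Implicit Types (x y : dbase N) (f : 'rV[R]_N) (Fc : seq 'rV[R]_N).

(** The unnormalized query value: it is additive in the entries, whereas the denominator of [qval]
    moves with the size. *)
Definition dotq f x : R := \sum_(i < N) f 0 i * (x i)%:R.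

Lemma qvalE f x : qval f x = dotq f x / (dbsize x)%:R.
Proof.
by rewrite /qval /dotq mulr_suml; apply: eq_bigr => i _; rewrite mxE mulrA.
Qed.

Lemma dbsize_add_entry x j : dbsize (add_entry x j) = (dbsize x).+1.
Proof.
rewrite /dbsize (eq_bigr (fun i => x i + (i == j))%N); last first.
  by move=> i _; rewrite ffunE.
rewrite big_split /= -addn1; congr addn.
by rewrite (bigD1 j)//= eqxx big1 ?addn0// => i /negbTE->.
Qed.

Lemma dotq_add_entry f x j : dotq f (add_entry x j) = dotq f x + f 0 j.
Proof.
rewrite /dotq (eq_bigr (fun i => f 0 i * (x i)%:R + f 0 i * (i == j)%:R)).
  rewrite big_split /=; congr +%R.
  by rewrite (bigD1 j)//= eqxx mulr1 big1 ?addr0// => i /negbTE->; rewrite mulr0.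
by move=> i _; rewrite ffunE natrD mulrDr.
Qed.

Lemma dotq_bounds f x : linear_query f -> 0 <= dotq f x <= (dbsize x)%:R.
Proof.
move=> lf; rewrite /dotq /dbsize natr_sum sumr_ge0/=; last first.
  by move=> i _; rewrite mulr_ge0//; case/andP: (lf i).
by apply: ler_sum => i _; rewrite ler_piMl//; case/andP: (lf i).
Qed.

Lemma qval_bounds f x : linear_query f -> 0 <= qval f x <= 1.
Proof.
move=> lf; rewrite qvalE; have /andP[d0 d1] := dotq_bounds x lf.
(* A database without entries has value 0, by the convention [0^-1 = 0]. *)
rewrite divr_ge0//=; have [->|s0] := posnP (dbsize x).
  by rewrite invr0 mulr0.
by rewrite ler_pdivrMr ?ltr0n// mul1r.
Qed.

Lemma qval_dist_le1 f x y : linear_query f -> `|qval f x - qval f y| <= 1.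
Proof.
move=> lf; have := qval_bounds x lf; have := qval_bounds y lf.
by rewrite ler_norml => /andP[? ?] /andP[? ?]; apply/andP; split; lra.
Qed.

Lemma qval_neighbor f x x' m : linear_query f -> (0 < m)%N ->
  dbsize x = m -> dbsize x' = m -> db_neighbor x x' ->
  `|qval f x - qval f x'| <= m%:R^-1.
Proof.
move=> lf m0 xm x'm [i [j [_ /(congr1 (dotq f))]]].
rewrite !dotq_add_entry !qvalE xm x'm -mulrBl normrM normfV normr_nat => e.
rewrite ler_piMl ?invr_ge0//.
have -> : dotq f x - dotq f x' = f 0 j - f 0 i by lra.
have := lf i; have := lf j; rewrite ler_norml => /andP[? ?] /andP[? ?].
by apply/andP; split; lra.
Qed.

Lemma query_dist_ub Fc x y f : f \in Fc -> `|qval f x - qval f y| <= query_dist Fc x y.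
Proof. by move=> fF; rewrite /query_dist; apply: (le_bigmax_seq 0 f predT). Qed.

Lemma query_dist_ge0 Fc x y : 0 <= query_dist Fc x y.
Proof. exact: bigmax_ge_id. Qed.

Lemma query_dist_le Fc x y d : 0 <= d ->
  (forall f, f \in Fc -> `|qval f x - qval f y| <= d) -> query_dist Fc x y <= d.
Proof.
by move=> d0 H; rewrite /query_dist big_seq; apply: bigmax_le.
Qed.

Lemma query_dist_neighbor Fc x x' y m : (forall f, f \in Fc -> linear_query f) ->
  (0 < m)%N -> dbsize x = m -> dbsize x' = m -> db_neighbor x x' ->
  query_dist Fc x y <= query_dist Fc x' y + m%:R^-1.
Proof.
move=> lF m0 xm x'm nb; apply: query_dist_le.
  by rewrite addr_ge0 ?query_dist_ge0 ?invr_ge0.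
move=> f fF; have h1 := query_dist_ub x' y fF.
have h2 := qval_neighbor (lF _ fF) m0 xm x'm nb.
have -> : qval f x - qval f y = (qval f x - qval f x') + (qval f x' - qval f y) by ring.
by rewrite (le_trans (ler_normD _ _))// addrC lerD.
Qed.

Lemma db_neighbor_sym x x' : db_neighbor x x' -> db_neighbor x' x.
Proof. by move=> [i [j [ij e]]]; exists j, i; rewrite eq_sym. Qed.

Lemma smallDB_weight_neighbor Fc eps x x' y m :
  (forall f, f \in Fc -> linear_query f) -> 0 <= eps ->
  (0 < m)%N -> dbsize x = m -> dbsize x' = m -> db_neighbor x x' ->
  smallDB_weight Fc eps m x y <= expR (eps / 2) * smallDB_weight Fc eps m x' y.
Proof.
move=> lF e0 m0 xm x'm nb; rewrite /smallDB_weight -expRD ler_expR.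
have := query_dist_neighbor y lF m0 x'm xm (db_neighbor_sym nb).
have m0' : 0 < m%:R :> R by rewrite ltr0n.
rewrite -(ler_pM2l m0') mulrDr divff ?gt_eqF// => h.
have := ler_wpM2l e0 h; lra.
Qed.

(** A finite support for [smallDB], listed through the same bounded count functions as its
    normalizing sum. *)
Definition dbs (l : nat) : seq (dbase N) :=
  [seq dbase_of z | z <- enum {ffun 'I_N -> 'I_l.+1} & dbsize (dbase_of z) == l].

Lemma dbase_of_inj l : injective (@dbase_of N l).
Proof.
move=> z z' /ffunP e; apply/ffunP => i; apply/val_inj.
by have := e i; rewrite !ffunE.
Qed.

Lemma uniq_dbs l : uniq (dbs l).
Proof.
rewrite map_inj_uniq; last exact: dbase_of_inj.
by rewrite filter_uniq// enum_uniq.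
Qed.

Lemma mem_dbs l y : (y \in dbs l) = (dbsize y == l).
Proof.
apply/mapP/idP => [[z]|/eqP yl].
  by rewrite mem_filter => /andP[/eqP zl _] ->; rewrite zl.
have yi i : (y i < l.+1)%N.
  by rewrite ltnS -yl /dbsize (bigD1 i)//= leq_addr.
have e : y = dbase_of [ffun i => Ordinal (yi i)].
  by apply/ffunP => i; rewrite !ffunE.
exists [ffun i => Ordinal (yi i)] => //.
by rewrite mem_filter mem_enum -e yl eqxx.
Qed.

Lemma sum_dbs l (F : dbase N -> R) :
  \sum_(b <- dbs l) F b =
  \sum_(z : {ffun 'I_N -> 'I_l.+1} | dbsize (dbase_of z) == l) F (dbase_of z).
Proof. by rewrite big_map big_filter big_enum_cond. Qed.

(* A database of size l is the multiset of entries of a word of length l. *)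
Lemma size_dbs_le l : (0 < N)%N -> (size (dbs l) <= N ^ l)%N.
Proof.
move=> N0.
pose word y := flatten [seq nseq (y i) i | i <- enum 'I_N].
have count_word y i : count_mem i (word y) = y i.
  rewrite /word count_flatten -map_comp sumnE big_map big_enum/=.
  rewrite (bigD1 i)//= count_nseq /= eqxx mul1n big1 ?addn0// => j ji.
  by rewrite count_nseq /= (negbTE ji).
have size_word y : size (word y) = dbsize y.
  rewrite /word size_flatten /shape -map_comp sumnE big_map big_enum/=.
  by apply: eq_bigr => i _ /=; rewrite size_nseq.
have : uniq (map word (dbs l)).
  rewrite map_inj_in_uniq ?uniq_dbs// => y y' _ _ e.
  by apply/ffunP => i; rewrite -!count_word e.
move=> uw; rewrite -(size_map word).
have -> : (N ^ l = size (map val (enum {: l.-tuple 'I_N})))%N.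
  by rewrite size_map -cardE card_tuple card_ord.
apply: uniq_leq_size uw _ => s /mapP[y]; rewrite mem_dbs => /eqP yl ->.
have sz : size (word y) == l by rewrite size_word yl.
by apply/mapP; exists (Tuple sz) => //; rewrite mem_enum.
Qed.

Lemma smallDB_dbs x Fc eps alpha m y :
  let l := smallDB_size (size Fc) alpha in
  smallDB x Fc eps alpha m y =
  if dbsize y == l then smallDB_weight Fc eps m x y /
    \sum_(z <- dbs l) smallDB_weight Fc eps m x z else 0.
Proof. by rewrite /smallDB /= sum_dbs. Qed.

Lemma smallDB_weight_gt0 Fc eps m x y : 0 < smallDB_weight Fc eps m x y.
Proof. exact: expR_gt0. Qed.

Lemma sum_weight_ge0 Fc eps m x l : 0 <= \sum_(z <- dbs l) smallDB_weight Fc eps m x z.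
Proof. by apply: sumr_ge0 => z _; rewrite ltW// smallDB_weight_gt0. Qed.

Lemma weight_le_sum Fc eps m x l y : dbsize y = l ->
  smallDB_weight Fc eps m x y <= \sum_(z <- dbs l) smallDB_weight Fc eps m x z.
Proof.
move=> yl; have yd : y \in dbs l by rewrite mem_dbs yl.
rewrite (big_rem y)//= lerDl; apply: sumr_ge0 => z _.
by rewrite ltW// smallDB_weight_gt0.
Qed.

Lemma smallDB_ge0 x Fc eps alpha m y : 0 <= smallDB x Fc eps alpha m y.
Proof.
rewrite smallDB_dbs /=; case: ifP => // _.
by rewrite divr_ge0 ?sum_weight_ge0// ltW// smallDB_weight_gt0.
Qed.

Lemma smallDB_notin x Fc eps alpha m y :
  y \notin dbs (smallDB_size (size Fc) alpha) -> smallDB x Fc eps alpha m y = 0.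
Proof. by rewrite mem_dbs smallDB_dbs /= => /negbTE->. Qed.

Lemma smallDB_sum_le1 x Fc eps alpha m :
  \sum_(y <- dbs (smallDB_size (size Fc) alpha)) smallDB x Fc eps alpha m y <= 1.
Proof.
set l := smallDB_size _ _.
rewrite (eq_big_seq (fun y => smallDB_weight Fc eps m x y /
    \sum_(z <- dbs l) smallDB_weight Fc eps m x z)); last first.
  by move=> y; rewrite mem_dbs smallDB_dbs /= => ->.
rewrite -mulr_suml; set S := \sum_(_ <- _) _.
by have [->|S0] := eqVneq S 0; rewrite ?mul0r// divff.
Qed.

(** One factor [expR (eps / 2)] pays for the change of the weight, the other for the change of the
    normalizing sum, bounded termwise with [x] and [x'] exchanged. *)
Lemma smallDB_neighbor Fc eps alpha x x' y m :
  (forall f, f \in Fc -> linear_query f) -> 0 <= eps ->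
  (0 < m)%N -> dbsize x = m -> dbsize x' = m -> db_neighbor x x' ->
  smallDB x Fc eps alpha m y <= expR eps * smallDB x' Fc eps alpha m y.
Proof.
move=> lF e0 m0 xm x'm nb; rewrite !smallDB_dbs /=.
case: ifP => [/eqP yl|_]; last by rewrite mulr0.
set S := \sum_(_ <- _) _; set S' := \sum_(_ <- _) _.
have S0 : 0 < S by apply: lt_le_trans (weight_le_sum _ _ _ _ yl); exact: smallDB_weight_gt0.
have S'0 : 0 < S' by apply: lt_le_trans (weight_le_sum _ _ _ _ yl); exact: smallDB_weight_gt0.
have SS' : S' <= expR (eps / 2) * S.
  rewrite /S /S' mulr_sumr; apply: ler_sum => z _.
  exact: smallDB_weight_neighbor (db_neighbor_sym nb).
have ww' := smallDB_weight_neighbor y lF e0 m0 xm x'm nb.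
rewrite mulrA ler_pdivlMr// mulrAC ler_pdivrMr//.
have -> : expR eps = expR (eps / 2) * expR (eps / 2) by rewrite -expRD; congr expR; lra.
rewrite -mulrA [leRHS](_ : _ = (expR (eps / 2) * smallDB_weight Fc eps m x' y) * (expR (eps / 2) * S)); last ring.
by apply: ler_pM => //; rewrite ltW// smallDB_weight_gt0.
Qed.

(* Derandomized Hoeffding bound: choosing the entries one at a time, some
   choice does not exceed the average growth of the exponential potential. *)
Lemma potential_db (q : 'I_N -> R) (H : seq 'rV[R]_N) (s : R) (l : nat) :
  (forall i, 0 <= q i) -> \sum_i q i = 1 ->
  (forall h, h \in H -> \sum_i q i * h 0 i = 0 /\ forall i, `|h 0 i| <= 1) ->
  0 <= s <= 2^-1 ->
  exists y : dbase N, dbsize y = l /\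
    \sum_(h <- H) expR (s * dotq h y) <= (size H)%:R * expR (2 * s ^+ 2 * l%:R).
Proof.
move=> q0 q1 Hh /andP[s0 s2]; elim: l => [|l [y [yl IH]]].
  exists [ffun=> 0%N]; split.
    by rewrite /dbsize big1// => i _; rewrite ffunE.
  rewrite mulr0 expR0 mulr1 (eq_bigr (fun=> 1)).
    by rewrite big_const_seq count_predT iter_addr_0.
  move=> h _; rewrite /dotq big1 ?mulr0 ?expR0// => i _.
  by rewrite ffunE mulr0.
set B := (X in _ <= X) in IH *.
pose Phi j := \sum_(h <- H) expR (s * dotq h (add_entry y j)).
pose B' := (size H)%:R * expR (2 * s ^+ 2 * l.+1%:R).
suff [j Hj] : exists j, Phi j <= B'.
  by exists (add_entry y j); rewrite dbsize_add_entry yl.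
apply/not_existsP => nH.
have {}nH j : B' < Phi j by rewrite ltNge; apply/negP; exact: nH.
have avg : \sum_j q j * Phi j <= B'.
  rewrite /Phi; under eq_bigr do rewrite mulr_sumr.
  rewrite exchange_big /=.
  have -> : B' = B * expR (2 * s ^+ 2).
    rewrite /B -mulrA -expRD /B'; congr (_ * expR _).
    by rewrite -natr1; ring.
  apply: le_trans (ler_wpM2r (expR_ge0 _) IH).
  rewrite mulr_suml big_seq [leRHS]big_seq; apply: ler_sum => h hH.
  have [h0 h1] := Hh h hH.
  under eq_bigr do rewrite dotq_add_entry mulrDr expRD mulrCA.
  rewrite -mulr_sumr ler_wpM2l ?expR_ge0//.
  apply: le_trans (expR_ge1Dx _).
  (* After the quadratic bound on the exponential, the linear term averages to 0 because [h] is
     centred under [q]. *)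
  apply: (@le_trans _ _ (\sum_i (q i + s * (q i * h 0 i) + q i * (2 * s ^+ 2)))).
    apply: ler_sum => i _.
    have -> : q i + s * (q i * h 0 i) + q i * (2 * s ^+ 2) = q i * (1 + s * h 0 i + 2 * s ^+ 2) by ring.
    apply: ler_wpM2l => //.
    have := h1 i; rewrite ler_norml => /andP[ha hb].
    apply: le_trans (expR_le_quad _) _.
      by apply: le_trans s2; rewrite ler_piMr.
    rewrite lerD2l ler_pM2l// exprMn ler_piMr ?sqr_ge0//.
    have : 0 <= (1 - h 0 i) * (1 + h 0 i) by apply: mulr_ge0; lra.
    lra.
  by rewrite !big_split /= q1 -mulr_sumr h0 mulr0 addr0 -mulr_suml q1 mul1r.
(* Every [Phi j] exceeds [B'] while their [q]-average does not, so every weight [q j] vanishes,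
   against total weight 1. *)
have : \sum_j q j * (Phi j - B') <= 0.
  under eq_bigr do rewrite mulrBr.
  by rewrite sumrB -mulr_suml q1 mul1r subr_le0.
have pos j : 0 <= q j * (Phi j - B') by rewrite mulr_ge0// subr_ge0 ltW.
move=> le0.
have /eqP : \sum_j q j * (Phi j - B') = 0.
  by apply/eqP; rewrite eq_le le0/= sumr_ge0.
rewrite psumr_eq0// => /allP all0.
have : \sum_i q i = 0.
  apply: big1 => i _; have := all0 i (mem_index_enum i).
  by rewrite mulf_eq0 subr_eq0 (gt_eqF (nH i)) orbF => /eqP.
by rewrite q1; apply/eqP; rewrite oner_neq0.
Qed.

(** [potential_db] is used with [s = alpha] and the histogram of [x] as [q]. It bounds
    [alpha * dotq h y] by [ln (2 k) + 2 alpha^2 l], and the hypothesis on [l] gives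
    [ln k <= alpha^2 l]. *)
Lemma small_db_exists Fc x (alpha : R) (l : nat) :
  (forall f, f \in Fc -> linear_query f) -> (1 < size Fc)%N -> (0 < dbsize x)%N ->
  0 < alpha <= 2^-1 -> ln (size Fc)%:R / alpha ^+ 2 <= l%:R ->
  exists y : dbase N, dbsize y = l /\ query_dist Fc x y <= 4 * alpha.
Proof.
move=> lF k1 x0 /andP[a0 a2] ll; set k := size Fc in k1 ll.
have lnk : 0 < ln k%:R :> R by rewrite ln_gt0// ltr1n.
have l0 : 0 < l%:R :> R by apply: lt_le_trans ll; rewrite divr_gt0// exprn_gt0.
pose q i : R := (x i)%:R / (dbsize x)%:R.
(* Both signs of each centred query, so that one-sided bounds control absolute values. *)
pose H := [seq f - const_mx (qval f x) | f <- Fc] ++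
          [seq const_mx (qval f x) - f | f <- Fc].
have x0' : (dbsize x)%:R != 0 :> R by rewrite pnatr_eq0 -lt0n.
have q1 : \sum_i q i = 1.
  by rewrite -mulr_suml -natr_sum divff.
have qf f : \sum_i q i * f 0 i = qval f x.
  by rewrite /qval; apply: eq_bigr => i _; rewrite mxE mulrC.
have [||h hH||y [yl Hy]] := @potential_db q H alpha l.
- by move=> i; rewrite divr_ge0.
- exact: q1.
- have dev f : f \in Fc -> \sum_i q i * (f 0 i - qval f x) = 0 /\
      forall i, `|f 0 i - qval f x| <= 1.
    move=> fF; split.
      under eq_bigr do rewrite mulrBr.
      by rewrite sumrB -mulr_suml q1 qf mul1r subrr.
    move=> i; have := lF _ fF i; have := qval_bounds x (lF _ fF).
    by rewrite ler_norml => /andP[? ?] /andP[? ?]; apply/andP; split; lra.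
  move: hH; rewrite mem_cat => /orP[] /mapP[f fF ->]; have [d1 d2] := dev f fF.
    by split => [|i]; [rewrite -[RHS]d1; apply: eq_bigr => i _|]; rewrite !mxE.
  split => [|i]; last by rewrite !mxE distrC.
  rewrite -[RHS]oppr0 -[in RHS]d1 -sumrN; apply: eq_bigr => i _.
  by rewrite !mxE; ring.
- by rewrite ltW.
exists y; split => //; apply: query_dist_le; first by rewrite mulr_ge0// ltW.
have sH : (size H)%:R = 2 * k%:R :> R.
  by rewrite size_cat !size_map addnn -muln2 natrM mulrC.
have key h : h \in H -> alpha * dotq h y <= 4 * alpha ^+ 2 * l%:R.
  move=> hH; have : expR (alpha * dotq h y) <= 2 * k%:R * expR (2 * alpha ^+ 2 * l%:R).
    rewrite -sH; apply: le_trans Hy; rewrite (big_rem h)//= lerDl.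
    by apply: sumr_ge0 => *; exact: expR_ge0.
  have k0 : 0 < k%:R :> R by rewrite ltr0n ltnW.
  (* As [k >= 2], the factor 2 costs at most a second [ln k]. *)
  have kk : 2 * k%:R <= expR (2 * ln k%:R) :> R.
    have -> : 2 * ln k%:R = ln k%:R + ln k%:R :> R by ring.
    by rewrite expRD lnK ?posrE// ler_pM2r// ler_nat.
  move=> /le_trans -/(_ _ (ler_wpM2r (expR_ge0 _) kk)).
  rewrite -expRD ler_expR => /le_trans; apply.
  rewrite ler_pdivrMr ?exprn_gt0// in ll.
  lra.
have key' h : h \in H -> dotq h y / l%:R <= 4 * alpha.
  move=> /key hk; rewrite ler_pdivrMr// -(ler_pM2l a0).
  by apply: (le_trans hk); rewrite expr2; lra.
have dotc (c : R) : dotq (const_mx c) y = c * l%:R.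
  rewrite /dotq -yl /dbsize natr_sum mulr_sumr.
  by apply: eq_bigr => i _; rewrite mxE.
have dotB f g : dotq (f - g) y = dotq f y - dotq g y.
  by rewrite /dotq -sumrB; apply: eq_bigr => i _; rewrite !mxE mulrBl.
move=> f fF; rewrite ler_norml; apply/andP; split.
  have /key' : f - const_mx (qval f x) \in H.
    by rewrite mem_cat; apply/orP; left; apply/mapP; exists f.
  rewrite dotB dotc mulrBl mulfK ?gt_eqF//.
  by rewrite qvalE [in qval f y]qvalE yl; lra.
have /key' : const_mx (qval f x) - f \in H.
  by rewrite mem_cat; apply/orP; right; apply/mapP; exists f.
rewrite dotB dotc mulrBl mulfK ?gt_eqF//.
by rewrite [in qval f y]qvalE yl.
Qed.

(** Analysis of the exponential mechanism: a database within [4 alpha] bounds the normalizing sum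
    below, so each database farther than [5 alpha] has probability at most
    [exp (- eps m alpha / 2)]; the list has at most [N^l] members. *)
Lemma smallDB_utility Fc x (eps alpha : R) (m : nat) :
  (forall f, f \in Fc -> linear_query f) -> (1 < size Fc)%N ->
  (0 < N)%N -> (0 < dbsize x)%N -> 0 <= eps -> 0 < alpha <= 2^-1 ->
  let l := smallDB_size (size Fc) alpha in
  \sum_(y <- dbs l | ~~ (query_dist Fc x y <= 5 * alpha)) smallDB x Fc eps alpha m y
  <= N%:R ^+ l * expR (- (eps * m%:R * alpha / 2)).
Proof.
move=> lF k1 N0 x0 e0 a0 /=; set l := smallDB_size _ _.
have [y0 [y0l hy0]] : exists y : dbase N, dbsize y = l /\ query_dist Fc x y <= 4 * alpha.
  by apply: small_db_exists => //; exact: natceil_ge.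
set w := expR _.
apply: (@le_trans _ _ (\sum_(y <- dbs l) w)).
  rewrite big_mkcond big_seq [leRHS]big_seq; apply: ler_sum => y yd.
  case: ifPn => [|_]; last exact: expR_ge0.
  rewrite -ltNge => hy; rewrite smallDB_dbs /= -/l -mem_dbs yd.
  set S := \sum_(_ <- _) _.
  have S0 : smallDB_weight Fc eps m x y0 <= S by exact: weight_le_sum.
  have S1 : 0 < S by apply: lt_le_trans S0; exact: smallDB_weight_gt0.
  rewrite ler_pdivrMr//; apply: le_trans (ler_wpM2l (expR_ge0 _) S0).
  rewrite /smallDB_weight -expRD ler_expR.
  have em : 0 <= eps * m%:R by rewrite mulr_ge0.
  have : eps * m%:R * query_dist Fc x y0 <= eps * m%:R * (4 * alpha) by rewrite ler_wpM2l.
  have : eps * m%:R * (5 * alpha) <= eps * m%:R * query_dist Fc x y by rewrite ler_wpM2l// ltW.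
  lra.
rewrite big_const_seq count_predT iter_addr_0 -[leLHS]mulr_natl ler_wpM2r ?expR_ge0//.
by rewrite -natrX ler_nat size_dbs_le.
Qed.

End Databases.

(** * The schedule: epochs, privacy and failure budgets, accuracy of each epoch *)

Section Schedule.
Context {R : realType}.
Variables (N k n : nat) (eps beta : R).
Hypotheses (N1 : (1 < N)%N) (k1 : (1 < k)%N) (n0 : (0 < n)%N).
Hypotheses (eps01 : 0 < eps < 1) (beta01 : 0 < beta < 1).

Local Notation p := (pG R).
Local Notation g := (gG R N k).
Local Notation gamma := (gammaG p g eps beta n).
Local Notation eps_ := (epoch_eps p g eps beta n).
Local Notation alpha_ := (epoch_alpha p g eps beta n).
Local Notation t_ := (epoch_time p g eps beta n).
Local Notation r_ := (real_time p g eps beta n).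

Local Notation LN := (@ln R N%:R).
Local Notation Lk := (@ln R k%:R).
Local Notation L := (ln beta^-1).

Lemma eps_gt0 : 0 < eps. Proof. by case/andP: eps01. Qed.
Lemma beta_gt0 : 0 < beta. Proof. by case/andP: beta01. Qed.
Lemma beta_lt1 : beta < 1. Proof. by case/andP: beta01. Qed.
Lemma n_gt0 : 0 < n%:R :> R. Proof. by rewrite ltr0n. Qed.

Lemma LN_ge : 2^-1 <= LN. Proof. by rewrite ln_ge_half// ler_nat. Qed.
Lemma Lk_ge : 2^-1 <= Lk. Proof. by rewrite ln_ge_half// ler_nat. Qed.
Lemma LN_gt0 : 0 < LN. Proof. by have := LN_ge; lra. Qed.
Lemma Lk_gt0 : 0 < Lk. Proof. by have := Lk_ge; lra. Qed.
Lemma L_gt0 : 0 < L.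
Proof. by rewrite ln_gt0// invf_gt1 ?beta_gt0// beta_lt1. Qed.

Lemma g_cube : g ^+ 3 = 64 * LN * Lk.
Proof.
have h : 0 <= 64 * LN * Lk by rewrite !mulr_ge0// ltW// ?LN_gt0 ?Lk_gt0.
by rewrite /gG -powR_mulrn ?powR_ge0// -powRrM mulVf ?pnatr_eq0// powRr1.
Qed.

Lemma g_gt0 : 0 < g.
Proof. by rewrite /gG powR_gt0// !mulr_gt0// ?LN_gt0 ?Lk_gt0. Qed.

(** For [p = 1/3] the exponents are [3/5] and [1/5]; as [g] is a cube root, both factors become
    fifth roots. *)
Lemma gammaE :
  gamma = (64 * (LN * Lk * L / (eps * n%:R))) `^ 5^-1.
Proof.
have h1 : 0 <= 64 * LN * Lk by rewrite !mulr_ge0// ltW// ?LN_gt0 ?Lk_gt0.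
have h2 : 0 <= L / (eps * n%:R).
  by rewrite divr_ge0 ?(ltW L_gt0)// mulr_ge0// ltW// eps_gt0.
have -> : 64 * (LN * Lk * L / (eps * n%:R)) = (64 * LN * Lk) * (L / (eps * n%:R)) by ring.
rewrite powRM// /gammaG /gG /pG -powRrM.
by congr (_ `^ _ * _ `^ _); field.
Qed.

Lemma gamma_base_gt0 : 0 < LN * Lk * L / (eps * n%:R).
Proof. by rewrite divr_gt0// !mulr_gt0// ?LN_gt0 ?Lk_gt0 ?L_gt0 ?eps_gt0 ?n_gt0. Qed.

Lemma gamma_gt0 : 0 < gamma.
Proof. by rewrite gammaE powR_gt0// mulr_gt0// gamma_base_gt0. Qed.

Lemma gamma_pow5 : gamma ^+ 5 = 64 * (LN * Lk * L / (eps * n%:R)).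
Proof.
have h : 0 <= 64 * (LN * Lk * L / (eps * n%:R)) by rewrite mulr_ge0// ltW// gamma_base_gt0.
by rewrite gammaE -powR_mulrn ?powR_ge0// -powRrM mulVf ?pnatr_eq0// powRr1.
Qed.

Lemma gamma_le : gamma <= 64 * (LN * Lk * L / (eps * n%:R)) `^ 5^-1.
Proof.
rewrite gammaE powRM// ?(ltW gamma_base_gt0)// ler_wpM2r ?powR_ge0//.
rewrite -[leRHS]powRr1//; apply: ler_powR; first by rewrite ler1n.
by rewrite invf_le1// ler1n.
Qed.

Lemma real_time_gt0 i : 0 < r_ i.
Proof. by rewrite /real_time mulr_gt0 ?n_gt0// exprn_gt0// addr_gt0// gamma_gt0. Qed.

Lemma epoch_time_ge i : r_ i <= (t_ i)%:R.
Proof. by rewrite -natceil_le ?(ltW (real_time_gt0 _)). Qed.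

Lemma epoch_time_ge_start i : (n <= t_ i)%N.
Proof.
rewrite -(ler_nat R); apply: le_trans (epoch_time_ge i).
rewrite /real_time ler_peMl// exprn_ege1// lerDl ltW// gamma_gt0//.
Qed.

Lemma epoch_time_gt0 i : (0 < t_ i)%N.
Proof. exact: leq_trans n0 (epoch_time_ge_start i). Qed.

(** Epoch times are unbounded, so a least index with [t < t_ i] exists; it is not 0 because
    [t_ 0 = n], and its predecessor is the epoch. *)
Lemma epoch_ofP t : (n <= t)%N ->
  let i := epoch_of p g eps beta n t in (t_ i <= t < t_ i.+1)%N.
Proof.
move=> nt; rewrite /epoch_of /=; set P := (X in xget _ X).
suff : P (xget 0%N P) by []; apply: xgetPex.
have [i Hi] := @expr_unbounded R gamma (t%:R / n%:R) gamma_gt0.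
have ex : exists i, (t < t_ i)%N.
  exists i; rewrite natceil_gt ?(ltW (real_time_gt0 _))//.
  by move: Hi; rewrite ltr_pdivrMr ?n_gt0.
case: (ex_minnP ex) => -[|j] tj jmin.
  move: tj; rewrite natceil_gt ?(ltW (real_time_gt0 _))//.
  by rewrite /real_time expr0 mul1r ltr_nat ltnNge nt.
exists j; rewrite /P /= tj andbT leqNgt; apply/negP => /jmin.
by rewrite ltnn.
Qed.

(** An integer below [t_ i.+1] is below the unrounded [(1 + gamma) * r_ i], and [r_ i <= t_ i];
    rounding thus costs nothing. *)
Lemma epoch_drift i t : (t_ i <= t < t_ i.+1)%N ->
  (t - t_ i)%:R / (t_ i)%:R <= gamma.
Proof.
move=> /andP[it]; rewrite natceil_gt ?(ltW (real_time_gt0 _))// => ti.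
have ti0 : 0 < (t_ i)%:R :> R by rewrite ltr0n epoch_time_gt0.
rewrite ler_pdivrMr// natrB//.
have e : r_ i.+1 = (1 + gamma) * r_ i by rewrite /real_time exprS mulrA.
have := ler_wpM2l (ltW gamma_gt0) (epoch_time_ge i).
have := epoch_time_ge i; rewrite e in ti.
lra.
Qed.

Lemma epoch_eps_ge0 i : 0 <= eps_ i.
Proof.
rewrite /epoch_eps; move: gamma_gt0 eps_gt0; move: (gamma) => u u0 e0.
by rewrite !mulr_ge0 ?invr_ge0 ?exprn_ge0// ?addr_ge0// ltW.
Qed.

Lemma epoch_eps_sum m : \sum_(i < m) eps_ i <= eps.
Proof.
have g0 := gamma_gt0.
have g1 : 1 + gamma != 0 by rewrite gt_eqF// addr_gt0.
(* Closed form of the partial sums of an arithmetic-geometric series with total [eps]. *)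
suff -> : \sum_(i < m) eps_ i =
    (1 - (1 + gamma + m%:R * gamma) / (1 + gamma) ^+ m.+1) * eps.
  rewrite ler_piMl ?(ltW eps_gt0)// gerBl divr_ge0// ?exprn_ge0//.
    have : 0 <= m%:R * gamma by rewrite mulr_ge0// ltW.
    lra.
  lra.
elim: m => [|m IH].
  by rewrite big_ord0 mul0r addr0 expr1 divff// subrr mul0r.
rewrite big_ord_recr /= IH /epoch_eps -mulrDl; congr (_ * _).
rewrite -natr1 !(exprS _ m.+1) !(exprS _ m).
have gm : (1 + gamma) ^+ m != 0 by rewrite expf_neq0.
by field; apply/andP.
Qed.

Lemma epoch_beta_sum m : \sum_(i < m) epoch_beta beta i <= beta.
Proof.
have b0 := beta_gt0.
(* The ratio [beta / (1 + beta)] is the one whose geometric series, started at the first power, has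
   total [beta]. *)
suff -> : \sum_(i < m) epoch_beta beta i = beta * (1 - (beta / (1 + beta)) ^+ m).
  rewrite ler_piMr ?(ltW b0)// gerBl exprn_ge0// divr_ge0 ?addr_ge0// ltW//.
elim: m => [|m IH]; first by rewrite big_ord0 expr0 subrr mulr0.
rewrite big_ord_recr /= IH /epoch_beta exprS.
have : 1 + beta != 0 by rewrite gt_eqF// addr_gt0.
by move=> ?; field.
Qed.

(** * Budgets and accuracies of single epochs for [beta <= 1/2] *)

Section SmallBeta.
Hypothesis beta2 : beta <= 2^-1.

Local Notation b_ i := (ln (epoch_beta beta i)^-1).
Local Notation E_ i := (eps_ i * (t_ i)%:R).

Lemma ln_epoch_beta i : b_ i = i.+1%:R * ln ((1 + beta) / beta).
Proof.
have b0 := beta_gt0.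
rewrite /epoch_beta -exprVn invf_div lnXn ?mulr_natl//.
by rewrite divr_gt0// addr_gt0.
Qed.

Lemma ln_epoch_beta_ge i : 2^-1 <= b_ i.
Proof.
have b0 := beta_gt0.
have h : 2^-1 <= ln ((1 + beta) / beta).
  by apply: ln_ge_half; rewrite ler_pdivlMr//; have := beta2; lra.
rewrite ln_epoch_beta; apply: (le_trans h).
by rewrite ler_peMl ?ler1n//; lra.
Qed.

(** Amounts to [beta (1 + beta) <= 1]. As [beta] tends to 1, [L] tends to 0 but
    [ln ((1 + beta) / beta)] does not, so [beta] must stay away from 1. *)
Lemma ln_epoch_beta_le i : b_ i <= i.+1%:R * (2 * L).
Proof.
have b0 := beta_gt0.
rewrite ln_epoch_beta ler_wpM2l//.
have -> : 2 * L = ln (beta^-1 * beta^-1).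
  by rewrite lnM ?posrE ?invr_gt0//; ring.
rewrite ler_ln ?posrE ?mulr_gt0 ?invr_gt0 ?addr_gt0//.
rewrite ler_pM2r ?invr_gt0// -[leRHS]div1r ler_pdivlMr//.
have : beta * beta <= 2^-1 * 2^-1 by rewrite ler_pM// ltW.
have := beta2; lra.
Qed.

(** The growth [(1 + gamma)^i] of the epoch times cancels the decay of [eps_ i]. The remaining
    factor [i + 1] matches the one in [ln_epoch_beta]. *)
Lemma epoch_budget_ge i : gamma ^+ 2 * i.+1%:R / (1 + gamma) ^+ 2 * (eps * n%:R) <= E_ i.
Proof.
have g0 := gamma_gt0; have g1 : 0 < 1 + gamma by rewrite addr_gt0.
apply: le_trans (ler_wpM2l (epoch_eps_ge0 i) (epoch_time_ge i)).
rewrite /epoch_eps /real_time.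
have h : (1 + gamma) ^+ i != 0 by rewrite expf_neq0// gt_eqF.
rewrite (_ : (1 + gamma) ^+ i.+2 = (1 + gamma) ^+ 2 * (1 + gamma) ^+ i); last first.
  by rewrite -exprD.
rewrite le_eqVlt; apply/orP; left; apply/eqP.
by field; rewrite h gt_eqF.
Qed.

Lemma epoch_budget_gt0 i : 0 < E_ i.
Proof.
have g0 := gamma_gt0; have e0 := eps_gt0; have := n_gt0 => n0'.
apply: lt_le_trans (epoch_budget_ge i).
have h : 0 < 1 + gamma by lra.
apply: mulr_gt0; last exact: mulr_gt0.
apply: divr_gt0; last exact: exprn_gt0.
by apply: mulr_gt0; [exact: exprn_gt0|rewrite ltr0n].
Qed.

Lemma epoch_alpha_cube i : alpha_ i ^+ 3 = 64 * LN * Lk * (b_ i / E_ i).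
Proof.
have h : 0 <= b_ i / E_ i.
  by rewrite divr_ge0 ?(ltW (epoch_budget_gt0 i))//; have := ln_epoch_beta_ge i; lra.
rewrite /epoch_alpha exprMn g_cube; congr (_ * _).
rewrite -powR_mulrn ?powR_ge0// -powRrM /pG mulVf ?pnatr_eq0// powRr1//.
Qed.

Lemma epoch_alpha_gt0 i : 0 < alpha_ i.
Proof.
rewrite /epoch_alpha mulr_gt0 ?g_gt0// powR_gt0// divr_gt0 ?(epoch_budget_gt0 i)//.
by have := ln_epoch_beta_ge i; lra.
Qed.

(** Cubes are compared: both factors [i + 1] cancel, and inserting [gamma_pow5] leaves
    [(1 + gamma)^2 <= 4]. *)
Lemma epoch_alpha_le i : gamma <= 1 -> alpha_ i <= 2 * gamma.
Proof.
move=> g1; have g0 := gamma_gt0; have e0 := eps_gt0; have n0' := n_gt0.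
have l1 := LN_gt0; have l2 := Lk_gt0; have l3 := L_gt0.
have g2 : 0 <= 2 * gamma by lra.
rewrite -(ler_pXn2r (n := 3))// ?nnegrE ?(ltW (epoch_alpha_gt0 i))//.
rewrite epoch_alpha_cube mulrA ler_pdivrMr ?epoch_budget_gt0//.
have h1 := ln_epoch_beta_le i.
apply: (@le_trans _ _ (64 * LN * Lk * (i.+1%:R * (2 * L)))).
  by rewrite ler_wpM2l// !mulr_ge0// ltW.
apply: (@le_trans _ _ ((2 * gamma) ^+ 3 *
   (gamma ^+ 2 * i.+1%:R / (1 + gamma) ^+ 2 * (eps * n%:R)))); last first.
  by rewrite ler_wpM2l ?exprn_ge0// epoch_budget_ge.
have -> : (2 * gamma) ^+ 3 * (gamma ^+ 2 * i.+1%:R / (1 + gamma) ^+ 2 * (eps * n%:R))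
  = 8 * gamma ^+ 5 * (eps * n%:R) * i.+1%:R / (1 + gamma) ^+ 2 by ring.
have en : eps * n%:R != 0 by rewrite mulf_neq0 ?gt_eqF.
have g5 : gamma ^+ 5 * (eps * n%:R) = 64 * (LN * Lk * L).
  by rewrite gamma_pow5 -mulrA divfK.
rewrite -(mulrA 8) g5.
rewrite ler_pdivlMr ?exprn_gt0 ?addr_gt0//.
have -> : 64 * LN * Lk * (i.+1%:R * (2 * L)) * (1 + gamma) ^+ 2 =
  (64 * LN * Lk * i.+1%:R * 2 * L) * (1 + gamma) ^+ 2 by ring.
have -> : 8 * (64 * (LN * Lk * L)) * i.+1%:R = (64 * LN * Lk * i.+1%:R * 2 * L) * 4 by ring.
rewrite ler_wpM2l//; first by rewrite !mulr_ge0// ltW.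
have : 0 <= (1 - gamma) * (3 + gamma) by apply: mulr_ge0; lra.
lra.
Qed.

(** With [c = LN * Lk * b_ i / a^2], the mechanism gains the exponent [32 c]. Since the logarithms
    are at least [1/2] and [a <= 1], the cost is at most [2 c + 4 c] for the number of databases
    (the [4 c] coming from rounding [l] up) and [4 c] for [b_ i]. *)
Lemma epoch_failure_le i : alpha_ i <= 1 ->
  N%:R ^+ smallDB_size k (alpha_ i) * expR (- (eps_ i * (t_ i)%:R * alpha_ i / 2))
  <= epoch_beta beta i.
Proof.
move=> a1; have a0 := epoch_alpha_gt0 i; have E0 := epoch_budget_gt0 i.
have b0 : 0 < epoch_beta beta i.
  by rewrite exprn_gt0// divr_gt0 ?addr_gt0// beta_gt0.
have N0 : 0 < N%:R :> R by rewrite ltr0n ltnW.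
set l := smallDB_size _ _.
have -> : N%:R ^+ l = expR (l%:R * LN) :> R.
  by rewrite -[in LHS](@lnK R N%:R) ?posrE// -expRM_natl.
have -> : epoch_beta beta i = expR (- b_ i).
  by rewrite lnV ?posrE// opprK lnK ?posrE.
rewrite -expRD ler_expR.
have [n1 k2 b1] : [/\ 2^-1 <= LN, 2^-1 <= Lk & 2^-1 <= b_ i].
  by split; [exact: LN_ge|exact: Lk_ge|exact: ln_epoch_beta_ge].
have l1 : l%:R <= Lk / alpha_ i ^+ 2 + 1.
  by apply/ltW/natceil_lt; rewrite divr_ge0 ?sqr_ge0//; lra.
set a := alpha_ i in a1 a0 l1 *.
have a20 : 0 < a ^+ 2 by rewrite exprn_gt0.
have Ea : E_ i * a = 64 * LN * Lk * b_ i / a ^+ 2.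
  apply: (mulIf (x := a ^+ 2)); rewrite ?gt_eqF// divfK ?gt_eqF//.
  have -> : E_ i * a * a ^+ 2 = E_ i * a ^+ 3 by ring.
  by rewrite epoch_alpha_cube mulrCA [E_ i * _]mulrC divfK ?gt_eqF.
set c := LN * Lk * b_ i / a ^+ 2.
have Ea' : E_ i * a = 64 * c by rewrite Ea /c; ring.
rewrite Ea'.
have a2 : 1 <= (a ^+ 2)^-1 by rewrite invf_ge1// expr_le1// ltW.
have c1 : LN * Lk / a ^+ 2 <= 2 * c.
  rewrite /c; set d := LN * Lk.
  have -> : 2 * (d * b_ i / a ^+ 2) = (d / a ^+ 2) * (2 * b_ i) by ring.
  rewrite ler_peMr//; last lra.
  by apply: divr_ge0; [apply: mulr_ge0; lra|exact: ltW].
have c2 : LN <= 4 * c.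
  have -> : 4 * c = LN * ((2 * Lk) * (2 * b_ i) * (a ^+ 2)^-1) by rewrite /c; ring.
  by rewrite ler_peMr//; [lra|apply: mulr_ege1 => //; apply: mulr_ege1; lra].
have c3 : b_ i <= 4 * c.
  have -> : 4 * c = b_ i * ((2 * LN) * (2 * Lk) * (a ^+ 2)^-1) by rewrite /c; ring.
  by rewrite ler_peMr//; [lra|apply: mulr_ege1 => //; apply: mulr_ege1; lra].
have c4 : l%:R * LN <= LN * Lk / a ^+ 2 + LN.
  have := ler_wpM2r (_ : 0 <= LN) l1.
  rewrite mulrDl mul1r [Lk / _ * _]mulrC mulrA; apply; lra.
lra.
Qed.

End SmallBeta.
End Schedule.

(** * Drift of query values along a stream *)

Section Stream.
Context {R : realType} {N : nat}.
Implicit Types (X : stream N) (f : 'rV[R]_N).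

Lemma dotq_stream n X f t d : is_stream n X -> linear_query f -> (n <= t)%N ->
  dotq f (X t) <= dotq f (X (t + d)%N) <= dotq f (X t) + d%:R.
Proof.
move=> sX lf nt; elim: d => [|d /andP[IH1 IH2]].
  by rewrite addn0 addr0 lexx.
rewrite addnS; have [_ [j ->]] := sX (t + d)%N (leq_trans nt (leq_addr _ _)).
rewrite dotq_add_entry -natr1; have /andP[f0 f1] := lf j.
by apply/andP; split; lra.
Qed.

(** New entries raise the value and the larger denominator lowers it. With [d = t - s] and [u = s],
    each effect contributes at most [d u] to the numerator over [u (u + d)], and they have opposite
    signs. *)
Lemma qval_stream_drift n X f s t : is_stream n X -> linear_query f ->
  (n <= s)%N -> (0 < s)%N -> (s <= t)%N ->
  `|qval f (X t) - qval f (X s)| <= (t - s)%:R / s%:R.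
Proof.
move=> sX lf ns s0 st.
have := dotq_stream (t - s) sX lf ns; rewrite subnKC// => /andP[h1 h2].
have [es _] := sX s ns; have [et _] := sX t (leq_trans ns st).
rewrite !qvalE es et.
have := dotq_bounds (X s) lf; rewrite es => /andP[a0 a1].
move: h1 h2 a0 a1; set a := dotq f (X s); set b := dotq f (X t).
have s0' : 0 < s%:R :> R by rewrite ltr0n.
have t0' : 0 < t%:R :> R by rewrite ltr0n (leq_trans s0 st).
have tE : t%:R = s%:R + (t - s)%:R :> R by rewrite -natrD subnKC.
move: tE s0' t0'; move: (s%:R) (t%:R) ((t - s)%:R : R) (ler0n R (t - s)).
move=> u v d d0 -> u0 v0 h1 h2 a0 a1.
have E : b / (u + d) - a / u = (b * u - a * (u + d)) / (u + d) / u.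
  by field; rewrite !gt_eqF.
rewrite E normrM normfV (gtr0_norm u0) ler_pM2r ?invr_gt0//.
rewrite normrM normfV (gtr0_norm v0) ler_pdivrMr//.
have k1 : a * u <= b * u by rewrite ler_pM2r.
have k2 : b * u <= (a + d) * u by rewrite ler_pM2r.
have k3 : a * d <= u * d by rewrite ler_wpM2r.
have k4 : 0 <= a * d by rewrite mulr_ge0.
have k5 : 0 <= d * d by rewrite mulr_ge0.
by rewrite ler_norml; apply/andP; split; lra.
Qed.

End Stream.

(** * Privacy and accuracy of the scheduler *)

Section SmallDBG.
Context {R : realType} {N k n : nat} {Fc : seq 'rV[R]_N} {eps beta : R}.
Hypotheses (N1 : (1 < N)%N) (k1 : (1 < k)%N) (n0 : (0 < n)%N).
Hypotheses (szF : size Fc = k) (lF : forall f, f \in Fc -> linear_query f).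
Hypotheses (eps01 : 0 < eps < 1) (beta01 : 0 < beta < 1).
Context {M : stream N -> probability (releases N) R}.
Hypothesis MP : smallDBG_releases Fc eps beta n M.

Local Notation p := (pG R).
Local Notation g := (gG R N k).
Local Notation gamma := (gammaG p g eps beta n).
Local Notation eps_ := (epoch_eps p g eps beta n).
Local Notation alpha_ := (epoch_alpha p g eps beta n).
Local Notation t_ := (epoch_time p g eps beta n).
Local Notation db_support :=
  (fun i => @dbs N (smallDB_size (size Fc) (alpha_ i))).
Local Notation db_law X :=
  (fun i => smallDB (X (t_ i)) Fc (eps_ i) (alpha_ i) (t_ i)).

Lemma smallDBG_product_law X : is_stream n X ->
  product_law (M X) (db_law X) db_support.
Proof.
move=> sX; split.
- by move=> j b; exact: smallDB_ge0.
- by move=> j b; exact: smallDB_notin.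
- by move=> j; exact: smallDB_sum_le1.
- by move=> m y; have := MP sX m y; rewrite szF.
Qed.

(** Answers are post-processing of the releases, so it suffices to compare the two laws on
    measurable sets of releases, hence on cylinders, hence on prefixes. *)
Lemma smallDBG_private F :
  diff_private n eps M (smallDBG_out k eps beta n F).
Proof.
move=> X X' sX sX' [t [nt Hlt Hge]] S mS.
apply: cylinder_ring_le mS; first exact: expR_ge0.
move=> A [mA [m HA]].
apply: (product_law_cylinder_le _ (smallDBG_product_law sX)
  (smallDBG_product_law sX') _ (expR_ge0 _) mA HA).
  by move=> j; exact: uniq_dbs.
move=> y.
have hm : expR (\sum_(i < m) eps_ i) <= expR eps.
  by rewrite ler_expR; exact: (epoch_eps_sum N1 k1 n0 eps01 beta01).
apply: (@le_trans _ _ (expR (\sum_(i < m) eps_ i) * \prod_(i < m) db_law X' i (y i))).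
  rewrite expR_sum -big_split /=; apply: ler_prod => i _.
  rewrite smallDB_ge0 /=.
  have nti := epoch_time_ge_start N1 k1 n0 eps01 beta01 i.
  have ei := epoch_eps_ge0 N1 k1 n0 eps01 beta01 i.
  (* Epochs starting before the streams part have identical laws; each later one costs a factor
     [expR (eps_ i)]. *)
  have [lt_t|ge_t] := ltnP (t_ i) t.
    rewrite Hlt ?nti// ler_peMl ?smallDB_ge0//.
    by rewrite -expR0 ler_expR.
  apply: smallDB_neighbor => //.
  - exact: leq_trans n0 nti.
  - by have [] := sX _ nti.
  - by have [] := sX' _ nti.
  - exact: Hge.
by apply: ler_wpM2r hm; apply: prodr_ge0 => i _; exact: smallDB_ge0.
Qed.

Definition accurate_set (F : query_stream R N) (alpha : R) (X : stream N) :
    set (releases N) :=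
  [set w | forall t j : nat, (n <= t)%N -> (j < size (F t))%N ->
    `|qval (nth 0 (F t) j) (X t) -
      nth 0 ((smallDBG_out k eps beta n F w).2 t) j| <= alpha].

Lemma accurate_setE F alpha X : accurate_set F alpha X =
  [set w | forall t j : nat, (n <= t)%N -> (j < size (F t))%N ->
    `|qval (nth 0 (F t) j) (X t) -
      qval (nth 0 (F t) j) (w (epoch_of p g eps beta n t))| <= alpha].
Proof.
by apply/seteqP; split => w /= H t j nt jF; have := H t j nt jF;
  rewrite (nth_map 0).
Qed.

(** A countable intersection of events that each depend on a single release. *)
Lemma measurable_accurate_set F alpha X : measurable (accurate_set F alpha X).
Proof.
rewrite accurate_setE.
rewrite [X in measurable X](_ : _ = \bigcap_t \bigcap_j
  ([set w | (n <= t)%N -> (j < size (F t))%N ->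
    `|qval (nth 0 (F t) j) (X t) -
      qval (nth 0 (F t) j) (w (epoch_of p g eps beta n t))| <= alpha]
   : set (releases N))); last first.
  apply/seteqP; split => w /= H.
    by move=> t _ j _; exact: H.
  by move=> t j; exact: H.
apply: bigcapT_measurable => t; apply: bigcapT_measurable => j.
exact: (@measurable_coord _ (epoch_of p g eps beta n t)
  [set b | (n <= t)%N -> (j < size (F t))%N ->
    `|qval (nth 0 (F t) j) (X t) - qval (nth 0 (F t) j) b| <= alpha]).
Qed.

Lemma accurate_ge1 F alpha : (forall t, (n <= t)%N -> {subset F t <= Fc}) ->
  1 <= alpha -> accurate n alpha beta F M (smallDBG_out k eps beta n F).
Proof.
move=> FF a1 X sX; rewrite -/(accurate_set F alpha X).
rewrite (_ : accurate_set F alpha X = setT).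
  rewrite probability_setT lee_fin lerBlDr lerDl ltW//.
  by case/andP: beta01.
rewrite accurate_setE; apply/seteqP; split => // w _ /= t j nt jF.
by apply: le_trans a1; apply/qval_dist_le1/lF/(FF t nt)/mem_nth.
Qed.

Definition epoch_failure (X : stream N) (i : nat) : set (releases N) :=
  [set w | ~~ (query_dist Fc (X (t_ i)) (w i) <= 5 * alpha_ i)].

Lemma epoch_failure_prob X i : is_stream n X -> beta <= 2^-1 ->
  alpha_ i <= 2^-1 -> (M X (epoch_failure X i) <= (epoch_beta beta i)%:E)%E.
Proof.
move=> sX b2 a2.
have nti := epoch_time_ge_start N1 k1 n0 eps01 beta01 i.
have [sz _] := sX _ nti.
apply: (product_law_marginal (smallDBG_product_law sX)
  (B := fun b => ~~ (query_dist Fc (X (t_ i)) b <= 5 * alpha_ i))).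
apply: le_trans (smallDB_utility _ lF _ _ _ _ _) _ => //.
- by rewrite szF.
- exact: ltnW.
- by rewrite sz; exact: leq_trans n0 nti.
- exact: (epoch_eps_ge0 N1 k1 n0 eps01 beta01).
- by rewrite (epoch_alpha_gt0 N1 k1 n0 eps01 beta01)//.
rewrite szF; apply: (epoch_failure_le N1 k1 n0 eps01 beta01) => //.
by lra.
Qed.

Lemma smallDBG_accurate F alpha :
  (forall t, (n <= t)%N -> {subset F t <= Fc}) ->
  beta <= 2^-1 -> gamma <= 16^-1 -> 16 * gamma <= alpha ->
  accurate n alpha beta F M (smallDBG_out k eps beta n F).
Proof.
move=> FF b2 g16 ga X sX; rewrite -/(accurate_set F alpha X).
have g0 := gamma_gt0 N1 k1 n0 eps01 beta01.
have ai i : alpha_ i <= 2 * gamma.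
  by apply: (epoch_alpha_le N1 k1 n0 eps01 beta01) => //; lra.
have mA := measurable_accurate_set F alpha X.
have mE i : measurable (epoch_failure X i).
  exact: (@measurable_coord _ i [set b | ~~ (query_dist Fc (X (t_ i)) b <= 5 * alpha_ i)]).
have sub : ~` accurate_set F alpha X `<=` \bigcup_i epoch_failure X i.
  move=> w nA; apply: contrapT => nU; apply: nA.
  rewrite accurate_setE /= => t j nt jF.
  have /= := epoch_ofP N1 k1 n0 eps01 beta01 nt.
  set i := epoch_of _ _ _ _ _ _ => it.
  have hw : query_dist Fc (X (t_ i)) (w i) <= 5 * alpha_ i.
    by apply/negP => /negP hn; apply: nU; exists i.
  have fF : nth 0 (F t) j \in Fc by apply/(FF t nt)/mem_nth.
  have h1 := query_dist_ub (X (t_ i)) (w i) fF.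
  have h2 := epoch_drift N1 k1 n0 eps01 beta01 it.
  have nti := epoch_time_ge_start N1 k1 n0 eps01 beta01 i.
  have /andP[tit _] := it.
  have h3 := qval_stream_drift sX (lF fF) nti (leq_trans n0 nti) tit.
  apply: le_trans (ler_distD (qval (nth 0 (F t) j) (X (t_ i))) _ _) _.
  (* Release error plus drift is at most [5 * (2 gamma) + gamma = 11 gamma], within
     [16 gamma <= alpha]. *)
  have := ai i; lra.
(* Union bound over all epochs, through the partial sums of the [epoch_beta]. *)
have fail : (M X (~` accurate_set F alpha X) <= beta%:E)%E.
  apply: (@le_trans _ _ (\sum_(i <oo) M X (epoch_failure X i))%E).
    by apply: measure_sigma_subadditive => //; exact: measurableC.
  apply: lime_le; first exact: is_cvg_nneseries.
  apply: nearW => m; rewrite big_mkord.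
  apply: (@le_trans _ _ (\sum_(i < m) (epoch_beta beta i)%:E)%E).
    apply: lee_sum => i _; apply: epoch_failure_prob => //.
    by have := ai i; lra.
  by rewrite sumEFin lee_fin; exact: epoch_beta_sum.
have mX := probability_setC (M X) mA.
rewrite [X in (X <= _)%E]mX in fail.
have fin : M X (accurate_set F alpha X) \is a fin_num by exact: fin_num_measure.
move: fail; rewrite -(fineK fin) -EFinB !lee_fin; lra.
Qed.

End SmallDBG.

Theorem theorem12 (R : realType) :
  exists C : R, 0 < C /\
  forall (N k n : nat) (Fc : seq 'rV[R]_N) (eps beta : R),
    (1 < N)%N -> (1 < k)%N -> (0 < n)%N ->
    uniq Fc -> size Fc = k -> (forall f, f \in Fc -> linear_query f) ->
    0 < eps < 1 -> 0 < beta < 1 ->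
  forall M : stream N -> probability (releases N) R,
    smallDBG_releases Fc eps beta n M ->
  (forall F : query_stream R N,
     diff_private n eps M (smallDBG_out k eps beta n F)) /\
  ((forall i, real_time (pG R) (gG R N k) eps beta n i \is a Num.nat) \/
     beta <= 2^-1 ->
   forall (F : query_stream R N) (alpha : R),
     (forall t, (n <= t)%N -> {subset F t <= Fc}) ->
     C * (ln N%:R * ln k%:R * ln beta^-1 / (eps * n%:R)) `^ 5^-1 <= alpha ->
     accurate n alpha beta F M (smallDBG_out k eps beta n F)).
Proof.
(* The factor 64 comes from [gamma_le], the factor 16 from the requirement [16 * gamma <= alpha] of
   [smallDBG_accurate]. *)
exists (16 * 64); split; first by rewrite mulr_gt0.
move=> N k n Fc eps beta N1 k1 n0 _ szF lF eps01 beta01 M MP; split.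
  by move=> F; exact: (smallDBG_private N1 k1 n0 szF lF eps01 beta01 MP).
move=> hyp F alpha FF ha.
have ga : 16 * gammaG (pG R) (gG R N k) eps beta n <= alpha.
  apply: le_trans ha; rewrite -mulrA ler_pM2l//.
  exact: (gamma_le N1 k1 n0 eps01 beta01).
have g0 := gamma_gt0 N1 k1 n0 eps01 beta01.
have [g16|g16] := leP (gammaG (pG R) (gG R N k) eps beta n) 16^-1; last first.
  by apply: (accurate_ge1 lF beta01 FF); lra.
case: hyp => [int|b2]; last exact: (smallDBG_accurate N1 k1 n0 szF lF eps01 beta01 MP).
(* Integral epoch times are incompatible with [gamma <= 1/16], so this case is vacuous. *)
suff : 1 <= gammaG (pG R) (gG R N k) eps beta n by lra.
apply: (@integral_powers_ge1 _ _ n%:R) => //; first by rewrite ltr0n.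
by move=> i; rewrite intrEge0 ?int//; exact/ltW/(real_time_gt0 N1 k1 n0 eps01 beta01).
Qed.
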